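(* The variety of orthogroupoids has the strong amalgamation property: for all orthogroupoids $\mathbf A,\mathbf B_1,\mathbf B_2$ with $A\neq\emptyset$ and embeddings $i:\mathbf A\to\mathbf B_1$, $j:\mathbf A\to\mathbf B_2$, there exist an orthogroupoid $\mathbf D$ and embeddings $h:\mathbf B_1\to\mathbf D$, $k:\mathbf B_2\to\mathbf D$ such that $h\circ i=k\circ j$ and $h(i(A))=k(j(A))=h(B_1)\cap k(B_2)$.
   Context: An orthogroupoid is an algebra $\langle D,+,',1\rangle$ of type $(2,1,0)$, with $0:=1'$, satisfying: (a) $x''\approx x$; (b) $0+x\approx x$ and $x+1\approx 1$; (c) $x+x'\approx 1$; (d) for all $x,z$: if $x+z=z$ and $x'+z=z$ then $z=1$; (e) $(((z+y)'+(z+x))'+(z+y)')+z'\approx z'$; (f) $x+(x+y)\approx x+y$ and $y+(x+y)\approx x+y$. Equivalently, (d) may be replaced by the identity $1+x\approx 1$, so orthogroupoids form a variety. *)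

(* Defs.v *)
From mathcomp Require Import all_boot.
From mathcomp Require Import boolp classical_sets.

Set Implicit Arguments.
Unset Strict Implicit.
Unset Printing Implicit Defensive.

Declare Scope ogpd_scope.
Delimit Scope ogpd_scope with ogpd.

Section OrthogroupoidLaws.
Variables (D : Type) (add : D -> D -> D) (compl : D -> D) (one : D).

Local Notation "x + y" := (add x y).
Local Notation "x ^'" := (compl x).
Local Notation "1" := one.
Local Notation "0" := (1^').

Record orthogroupoid_laws : Prop := OrthogroupoidLawsBuild {
  ogpd_complK : forall x, x^'^' = x;
  ogpd_add0 : forall x, 0 + x = x;
  ogpd_addx1 : forall x, x + 1 = 1;
  ogpd_addxC : forall x, x + x^' = 1;
  ogpd_eq1 : forall x z, x + z = z -> x^' + z = z -> z = 1;
  ogpd_orth : forall x y z,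
    (((z + y)^' + (z + x))^' + (z + y)^') + z^' = z^';
  ogpd_addKl : forall x y, x + (x + y) = x + y;
  ogpd_addKr : forall x y, y + (x + y) = x + y
}.

End OrthogroupoidLaws.

Record orthogroupoid := Orthogroupoid {
  ogpd_sort :> Type;
  ogpd_add : ogpd_sort -> ogpd_sort -> ogpd_sort;
  ogpd_compl : ogpd_sort -> ogpd_sort;
  ogpd_one : ogpd_sort;
  ogpdP : orthogroupoid_laws ogpd_add ogpd_compl ogpd_one
}.

Arguments ogpd_one {o}.

Notation "x + y" := (ogpd_add x y) : ogpd_scope.
Notation "x ^'" := (ogpd_compl x) : ogpd_scope.
Notation "1" := ogpd_one : ogpd_scope.

Record ogpd_embedding (A B : orthogroupoid) (f : A -> B) : Prop :=
  OgpdEmbedding {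
    ogpd_embD : forall x y : A, f (x + y)%ogpd = (f x + f y)%ogpd;
    ogpd_embC : forall x : A, f (x^')%ogpd = ((f x)^')%ogpd;
    ogpd_emb1 : f 1%ogpd = 1%ogpd;
    ogpd_emb_inj : injective f
  }.

(* Main.v *)
Require Import Defs.
From mathcomp Require Import all_boot.
From mathcomp Require Import boolp classical_sets.

(** The amalgam is the set-theoretic one: glue [B1] and [B2] along [A], keep the
operations of each [Bi], and put [x + y := 1] whenever [x] and [y] lie in no
common [Bi].  Writing [x R y] for [x + y = y], axiom (e) says that
[z R u] and [z R w] imply [((u' + w)' + u') R z'].  In the amalgam [x R y]
forces [y = 1] or [x] and [y] to lie in a common [Bi], so either [u' + w = 1],
and the conclusion is the antitonicity of complementation, or by pigeonhole
[z], [u] and [w] all lie in one [Bi]. *)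

Local Open Scope classical_set_scope.
Local Open Scope ogpd_scope.

(** * Consequences of axiom (e) inside one orthogroupoid *)

Lemma ogpd_orth_rel {B : orthogroupoid} {z u w : B} :
  z + u = u -> z + w = w -> ((u^' + w)^' + u^') + z^' = z^'.
Proof. by move=> zu zw; have := ogpd_orth (ogpdP B) w u z; rewrite zu zw. Qed.

(** This is the case [w = 1] of [ogpd_orth_rel]: the inner sum collapses to [1], whose complement
    [0] is a left unit. *)
Lemma ogpd_compl_anti {B : orthogroupoid} {z u : B} :
  z + u = u -> u^' + z^' = z^'.
Proof.
move=> zu; have := ogpd_orth_rel zu (ogpd_addx1 (ogpdP B) z).
by rewrite (ogpd_addx1 (ogpdP B)) (ogpd_add0 (ogpdP B)).
Qed.

(** * Operations on a set-theoretic amalgam of two orthogroupoids *)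

Section Gluing.
Context {A : orthogroupoid} {B : bool -> orthogroupoid}.
Context {e : forall b, A -> B b} (he : forall b, ogpd_embedding (e b)).
Context {D : Type} {h : forall b, B b -> D}.
Hypothesis h_inj : forall b, injective (h b).
Hypothesis h_surj : forall d, exists b, range (h b) d.
Hypothesis h_glue : forall a, h true (e true a) = h false (e false a).
Hypothesis h_meet : forall x y, h true x = h false y ->
  exists2 a, x = e true a & y = e false a.

Lemma glueE b c a : h b (e b a) = h c (e c a).
Proof. by case: b; case: c. Qed.

(** Only the mixed cases need an argument: a point with representatives in both factors comes from
    [A] by [h_meet], and the embeddings commute with the operation. *)
Lemma glue_compl_wd b c x y : h b x = h c y -> h b (x^') = h c (y^').
Proof.
case: b x; case: c y => y x.
- by move=> /h_inj ->.
- by move=> /h_meet[a -> ->]; rewrite -!(ogpd_embC (he _)); apply: glueE.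
- by move=> /esym/h_meet[a -> ->]; rewrite -!(ogpd_embC (he _)); apply: glueE.
- by move=> /h_inj ->.
Qed.

Lemma glue_compl_subproof d :
  exists d', forall b x, d = h b x -> d' = h b (x^').
Proof.
have [b [x _ <-]] := h_surj d.
by exists (h b (x^')) => c y; apply: glue_compl_wd.
Qed.

Definition glue_compl d : D := sval (cid (glue_compl_subproof d)).

Lemma glue_complE b x : glue_compl (h b x) = h b (x^').
Proof. by rewrite /glue_compl; case: cid => d' /=; apply. Qed.

Definition glue_one : D := h true 1.

Lemma glue_oneE b : h b 1 = glue_one.
Proof. by rewrite /glue_one -!(ogpd_emb1 (he _)); apply: glueE. Qed.

Lemma glue_add_wd b c x y x' y' : h b x = h c x' -> h b y = h c y' ->
  h b (x + y) = h c (x' + y').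
Proof.
case: b x y; case: c x' y' => x' y' x y.
- by move=> /h_inj -> /h_inj ->.
- move=> /h_meet[a -> ->] /h_meet[a' -> ->].
  by rewrite -!(ogpd_embD (he _)); apply: glueE.
- move=> /esym/h_meet[a -> ->] /esym/h_meet[a' -> ->].
  by rewrite -!(ogpd_embD (he _)); apply: glueE.
- by move=> /h_inj -> /h_inj ->.
Qed.

Definition common (d d' : D) := exists b, range (h b) d /\ range (h b) d'.

Lemma glue_add_subproof d d' : exists s,
  (forall b x y, d = h b x -> d' = h b y -> s = h b (x + y)) /\
  (~ common d d' -> s = glue_one).
Proof.
have [[b [[x _ <-] [y _ <-]]]|ncd] := pselect (common d d').
  exists (h b (x + y)); split=> [c x' y'|[]]; first exact: glue_add_wd.
  by exists b; split; [exists x|exists y].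
exists glue_one; split=> // b x y dE d'E.
by case: ncd; exists b; split; [exists x|exists y].
Qed.

Definition glue_add d d' : D := sval (cid (glue_add_subproof d d')).

Lemma glue_addE b x y : glue_add (h b x) (h b y) = h b (x + y).
Proof. by rewrite /glue_add; case: cid => s /= [sE _]; apply: sE. Qed.

Lemma glue_addP d d' : common d d' \/ glue_add d d' = glue_one.
Proof.
have [cd|ncd] := pselect (common d d'); first by left.
by right; rewrite /glue_add; case: cid => s /= [_ ->].
Qed.

Local Notation "d ⊕ d'" := (glue_add d d') (at level 50, left associativity).
Local Notation "d ^c" := (glue_compl d) (at level 2, format "d ^c").

Lemma glue_complK d : d^c^c = d.
Proof.
by have [b [x _ <-]] := h_surj d; rewrite !glue_complE (ogpd_complK (ogpdP _)).
Qed.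

Lemma glue_add0 d : glue_one^c ⊕ d = d.
Proof.
have [b [x _ <-]] := h_surj d.
by rewrite -(glue_oneE b) glue_complE glue_addE (ogpd_add0 (ogpdP _)).
Qed.

Lemma glue_addx1 d : d ⊕ glue_one = glue_one.
Proof.
have [b [x _ <-]] := h_surj d.
by rewrite -(glue_oneE b) glue_addE (ogpd_addx1 (ogpdP _)).
Qed.

Lemma glue_addxC d : d ⊕ d^c = glue_one.
Proof.
have [b [x _ <-]] := h_surj d.
by rewrite glue_complE glue_addE (ogpd_addxC (ogpdP _)) glue_oneE.
Qed.

(** Without a common factor the first hypothesis already reads [1 = z]. Otherwise [d^c] lies in the
    same factor, and axiom (d) applies there. *)
Lemma glue_eq1 d z : d ⊕ z = z -> d^c ⊕ z = z -> z = glue_one.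
Proof.
have [[b [[x _ <-] [y _ <-]]]|-> //] := glue_addP d z.
rewrite glue_complE !glue_addE => /h_inj xy /h_inj x'y.
by rewrite (ogpd_eq1 (ogpdP _) xy x'y) glue_oneE.
Qed.

Lemma glue_addKl d d' : d ⊕ (d ⊕ d') = d ⊕ d'.
Proof.
have [[b [[x _ <-] [y _ <-]]]|->] := glue_addP d d'; last exact: glue_addx1.
by rewrite !glue_addE (ogpd_addKl (ogpdP _)).
Qed.

Lemma glue_addKr d d' : d' ⊕ (d ⊕ d') = d ⊕ d'.
Proof.
have [[b [[x _ <-] [y _ <-]]]|->] := glue_addP d d'; last exact: glue_addx1.
by rewrite !glue_addE (ogpd_addKr (ogpdP _)).
Qed.

Lemma glue_relP d d' : d ⊕ d' = d' -> common d d' \/ d' = glue_one.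
Proof. by move=> dd'; have [?|dd'1] := glue_addP d d'; [left|right; rewrite -dd']. Qed.

Lemma glue_compl_anti z u : z ⊕ u = u -> u^c ⊕ z^c = z^c.
Proof.
move=> zu; have [[b [[x _ xz] [y _ yu]]]|->] := glue_relP _ _ zu; last exact: glue_add0.
move: zu; rewrite -xz -yu !glue_complE !glue_addE => /h_inj zu.
by rewrite (ogpd_compl_anti zu).
Qed.

Lemma range_one b : range (h b) glue_one.
Proof. by exists 1; rewrite // glue_oneE. Qed.

Lemma range_compl b d : range (h b) d^c -> range (h b) d.
Proof. by move=> [x _ xd]; exists (x^'); rewrite // -glue_complE xd glue_complK. Qed.

(** Pigeonhole: there are three pairs but two factors, so two of the pairs share a factor, and any
    two of the pairs cover all three points. *)
Lemma common_triple z u w : common z u -> common z w -> common u w ->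
  exists b, [/\ range (h b) z, range (h b) u & range (h b) w].
Proof.
move=> [b1 [z1 u1]] [b2 [z2 w2]] [b3 [u3 w3]].
have [?|/eqP ne12] := eqVneq b1 b2; first by subst b2; exists b1.
have [?|/eqP ne13] := eqVneq b1 b3; first by subst b3; exists b1.
suff eq23 : b2 = b3 by subst b3; exists b2.
by move: ne12 ne13; clear; case: b1; case: b2; case: b3.
Qed.

Lemma glue_orth_rel z u w : z ⊕ u = u -> z ⊕ w = w ->
  ((u^c ⊕ w)^c ⊕ u^c) ⊕ z^c = z^c.
Proof.
(* If [u^c] and [w] have no common factor, their sum is [1], and what remains is antitonicity of the
   complement. *)
move=> zu zw; have [cuw|->] := glue_addP (u^c) w; last first.
  by rewrite glue_add0; apply: glue_compl_anti.
have {cuw} cuw : common u w.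
  by case: cuw => b [/range_compl ub wb]; exists b.
suff [b [[x _ xz] [y _ yu] [t _ tw]]] :
    exists b, [/\ range (h b) z, range (h b) u & range (h b) w].
  move: zu zw; rewrite -xz -yu -tw !glue_complE.
  rewrite !(glue_complE, glue_addE) => /h_inj zu /h_inj zw.
  by rewrite (ogpd_orth_rel zu zw).
(* A point equal to [1] lies in both factors, so it never restricts the choice of a factor; only the
   first case needs the pigeonhole. *)
have [czu|u1] := glue_relP _ _ zu; have [czw|w1] := glue_relP _ _ zw.
- exact: common_triple.
- by case: czu => b [zb ub]; exists b; split=> //; rewrite w1; apply: range_one.
- by case: czw => b [zb wb]; exists b; split=> //; rewrite u1; apply: range_one.
- have [b zb] := h_surj z.
  by exists b; split=> //; rewrite ?u1 ?w1; apply: range_one.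
Qed.

Lemma glue_laws : orthogroupoid_laws glue_add glue_compl glue_one.
Proof.
split.
- exact: glue_complK.
- exact: glue_add0.
- exact: glue_addx1.
- exact: glue_addxC.
- exact: glue_eq1.
(* Axiom (e) is the relational form at [u = z + y] and [w = z + x]; its two premises are instances
   of (f). *)
- by move=> x y z; apply: glue_orth_rel; apply: glue_addKl.
- exact: glue_addKl.
- exact: glue_addKr.
Qed.

Definition glue : orthogroupoid := Orthogroupoid glue_laws.

Lemma glue_embedding b : @ogpd_embedding (B b) glue (h b).
Proof.
split=> [x y|x||].
- exact/esym/glue_addE.
- exact/esym/glue_complE.
- exact: glue_oneE.
- exact: h_inj.
Qed.

End Gluing.

(** * The pushout of two injections of sets *)

Section Pushout.
Context {A B1 B2 : Type} {i : A -> B1} {j : A -> B2}.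
Hypotheses (i_inj : injective i) (j_inj : injective j).

(** A disjoint union avoids a quotient: points coming from [A] are represented on the [B1] side
    only. *)
Definition pushout : Type := (B1 + {y : B2 | ~ range j y})%type.

Definition pushl (x : B1) : pushout := inl x.

Definition pushr (y : B2) : pushout :=
  match pselect (range j y) with
  | left jy => inl (i (s2val (cid2 jy)))
  | right njy => inr (exist _ y njy)
  end.

Lemma pushl_inj : injective pushl.
Proof. by move=> x y []. Qed.

(** [pushr] chooses some preimage under [j]; injectivity of [j] forces it to be [a]. *)
Lemma push_glue a : pushl (i a) = pushr (j a).
Proof.
rewrite /pushr; case: pselect => [ja|[]]; last by exists a.
by case: cid2 => a' _ /= /j_inj ->.
Qed.

Lemma push_meet x y : pushl x = pushr y -> exists2 a, x = i a & y = j a.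
Proof.
rewrite /pushr; case: pselect => [jy|//]; case: cid2 => a _ /= <- [->].
by exists a.
Qed.

Lemma pushr_inj : injective pushr.
Proof.
move=> y y'; have [[a _ <-]|njy] := pselect (range j y).
  (* A point of [range j] can be moved to the left side, where [push_meet] decides the equality. *)
  by rewrite -push_glue => /push_meet[a' /i_inj <- ->].
have [[a' _ <-]|njy'] := pselect (range j y').
  rewrite -push_glue => /esym/push_meet[a _ yE].
  by case: njy; exists a.
rewrite /pushr; case: pselect => [//|n]; case: pselect => [//|n'].
by case.
Qed.

Lemma push_surj d : range pushl d \/ range pushr d.
Proof.
case: d => [x|[y njy]]; first by left; exists x.
right; exists y => //; rewrite /pushr; case: pselect => [//|njy'].
(* The two points differ only in the proof that [y] is outside [range j]. *)
by congr (inr (exist _ _ _)); apply: Prop_irrelevance.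
Qed.

End Pushout.

Theorem theorem4p1 (A B1 B2 : orthogroupoid) (i : A -> B1) (j : A -> B2)
    (hA : [set: A] <> set0)
    (hi : ogpd_embedding i) (hj : ogpd_embedding j) :
  exists (D : orthogroupoid) (h : B1 -> D) (k : B2 -> D),
    [/\ ogpd_embedding h, ogpd_embedding k,
        h \o i = k \o j,
        h @` (range i) = k @` (range j) &
        k @` (range j) = range h `&` range k].
Proof.
have i_inj := ogpd_emb_inj hi; have j_inj := ogpd_emb_inj hj.
pose B b := if b then B1 else B2.
pose e b : A -> B b := if b return A -> B b then i else j.
pose P := @pushout A B1 B2 j.
pose h b : B b -> P :=
  if b return B b -> P then @pushl A B1 B2 j else @pushr A B1 B2 i j.
have he b : ogpd_embedding (e b) by case: b.
have h_inj b : injective (h b) by case: b; [exact: pushl_inj|exact: pushr_inj].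
have h_surj d : exists b, range (h b) d.
  by case: (@push_surj A B1 B2 i j d); [exists true|exists false].
have h_glue a : h true (e true a) = h false (e false a) by exact: push_glue.
have h_meet x y : h true x = h false y ->
  exists2 a, x = e true a & y = e false a by exact: push_meet.
have h_emb := glue_embedding he h_inj h_surj h_glue h_meet.
exists (glue he h_inj h_surj h_glue h_meet), (h true), (h false); split.
- exact: (h_emb true).
- exact: (h_emb false).
- exact/funext.
- by rewrite !image_comp; congr (_ @` _); apply/funext.
(* Strongness: by [h_meet], a point in both images comes from [A]. *)
- apply/seteqP; split=> [_ [_ [a _ <-] <-]|d [[x _ <-] [y _ /esym hxy]]].
    by split; [exists (i a); rewrite // (h_glue a)|exists (j a)].
  have [a _ yE] := h_meet _ _ hxy.
  by exists y; rewrite // yE; exists a.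
Qed.
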